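(* Let $G=K_{n_1,n_2,\dots,n_r}$ be a complete multipartite graph, where $r\geq 3$ and $1\leq n_1\leq n_2\leq\dots\leq n_r$. Let $k$ be an integer with $3\leq k\leq |V(G)|=\sum_{i=1}^{r}n_i$. Set $s=\sum_{i=1}^{r-1}n_i$ and $t=n_r$. If $t\geq s\geq 2(k-1)$ or $t\leq s$, then $px_k(G)=2$.
   Context: All graphs are simple, finite, undirected and connected. $K_{n_1,\dots,n_r}$ denotes the complete $r$-partite graph with partite sets of sizes $n_1,\dots,n_r$ (two vertices are adjacent if and only if they lie in different partite sets). An edge-coloring of a graph $G$ is any map $c:E(G)\to\{1,\dots,m\}$, $m\in\mathbb{N}$ (adjacent edges may receive the same color). A tree $T$ that is a subgraph of an edge-colored graph $G$ is a proper tree if no two adjacent edges of $T$ are assigned the same color. For $S\subseteq V(G)$, an $S$-tree is a tree that is a subgraph of $G$ and contains all vertices of $S$. For a connected graph $G$ of order $n$ and an integer $k$ with $2\le k\le n$, a $k$-proper coloring of $G$ is an edge-coloring such that for every set $S$ of $k$ vertices of $G$ there exists a proper $S$-tree in $G$. The $k$-proper index $px_k(G)$ is the minimum number of colors required in a $k$-proper coloring of $G$. *)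

(* Defs.v *)
From mathcomp Require Import all_boot.

Set Implicit Arguments.
Unset Strict Implicit.
Unset Printing Implicit Defensive.

(* The vertex set is a subset of an ambient finite type T, so that a graph and
   its subgraphs are objects of the same type. *)
Record sgraph (T : finType) := SGraph {
  verts : {set T};
  edges : {set {set T}};
  edgesP : forall e, e \in edges -> (e \subset verts) && (#|e| == 2)
}.

Section Graphs.
Variable T : finType.
Implicit Types (G H : sgraph T) (S : {set T}).

Definition adj G : rel T := fun x y => [set x; y] \in edges G.

Definition connected_graph G : Prop :=
  verts G != set0 /\
  (forall x y, x \in verts G -> y \in verts G -> connect (adj G) x y).

Definition acyclic G : Prop :=
  forall p : seq T, 2 < size p -> ~~ ucycleb (adj G) p.

Definition is_tree G : Prop := connected_graph G /\ acyclic G.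

Definition subgraph H G : Prop :=
  verts H \subset verts G /\ edges H \subset edges G.

Definition edge G := {e : {set T} | e \in edges G}.

Definition edge_coloring G (m : nat) := edge G -> 'I_m.

Definition proper_in G m (c : edge_coloring G m) H : Prop :=
  forall e f : edge G, val e \in edges H -> val f \in edges H ->
    e != f -> ~~ [disjoint val e & val f] -> c e != c f.

Definition steiner_tree G S H : Prop :=
  [/\ is_tree H, subgraph H G & S \subset verts H].

Definition k_proper_coloring (k : nat) G m (c : edge_coloring G m) : Prop :=
  forall S, S \subset verts G -> #|S| = k ->
    exists H, steiner_tree G S H /\ proper_in c H.

Definition k_proper_colorable (k : nat) G (m : nat) : Prop :=
  exists c : edge_coloring G m, k_proper_coloring k c.

(* px_k(G) = m, stated as a relation: m is the least element of the set of all
   numbers of colors admitting a k-proper coloring. *)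
Definition is_proper_index (k : nat) G (m : nat) : Prop :=
  k_proper_colorable k G m /\
  (forall m', k_proper_colorable k G m' -> m <= m').

End Graphs.

Section CompleteMultipartite.
Variables (r : nat) (n : r.-tuple nat).

(* The pair (i, j) is the j-th vertex of the i-th partite set. *)
Definition mp_vertex : finType := {i : 'I_r & 'I_(tnth n i)}.

Definition mp_edges : {set {set mp_vertex}} :=
  [set [set x; y] | x in mp_vertex, y in mp_vertex & tag x != tag y].

Fact mp_edgesP e :
  e \in mp_edges -> (e \subset [set: mp_vertex]) && (#|e| == 2).
Proof.
case/imset2P=> x y _; rewrite !inE /= => xy ->.
rewrite subsetT cards2 /=.
by have -> : x != y by apply: contraNneq xy => ->.
Qed.

Definition complete_multipartite : sgraph mp_vertex := SGraph mp_edgesP.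

End CompleteMultipartite.

(* Main.v *)
Require Import Defs.
From mathcomp Require Import all_boot zify.

(* A proper tree with 2 colors is an alternating path.  Color an edge by whether
   it leaves a class of even number, when the vertices are split into classes
   numbered modulo 4 and the edge goes from a class to the next one: every path
   going from each class to the next one alternates.
   If t <= s, there is a Hamiltonian path, and the classes are the indices along
   it.  If t >= s >= 2(k-1), split each side of the spanning K_{s,t} into two
   classes of at least k-1 vertices, so that odd classes form one side and even
   classes the other; a path winding through the four classes k-1 times, plus
   possibly one vertex, catches any k given vertices.
   One color never suffices, as a tree with 3 vertices has two adjacent edges. *)

Set Implicit Arguments.
Unset Strict Implicit.
Unset Printing Implicit Defensive.

(** * Paths as trees, and alternation along them *)

Lemma set2_inj (T : finType) (x y a b : T) :
  [set x; y] = [set a; b] -> (x = a /\ y = b) \/ (x = b /\ y = a).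
Proof.
move/setP=> E; move: (E x) (E y) (E a) (E b).
rewrite !inE !eqxx ?orbT /=.
case/esym/orP=> /eqP -> /esym/orP[] /eqP ->; rewrite ?eqxx ?orbT ?orbb; auto.
- by move=> _ /eqP ->; auto.
- by move=> /eqP ->; auto.
Qed.

Section PathGraph.
Variables (T : finType) (x0 : T) (p : seq T).

Definition path_edge i := [set nth x0 p i; nth x0 p i.+1].

Definition path_edges := [set path_edge i | i : 'I_(size p).-1].

Lemma path_edgesI i : i.+1 < size p -> path_edge i \in path_edges.
Proof.
move=> lti; have lti' : i < (size p).-1 by lia.
by apply/imsetP; exists (Ordinal lti').
Qed.

Lemma path_edgesE e :
  e \in path_edges -> exists2 i, i.+1 < size p & e = path_edge i.
Proof. by case/imsetP=> i _ ->; exists i => //; have := ltn_ord i; lia. Qed.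

Hypothesis Up : uniq p.

Lemma index_path_edge i x :
  i.+1 < size p -> x \in path_edge i -> index x p = i \/ index x p = i.+1.
Proof.
move=> lti; rewrite !inE => /orP[] /eqP ->; rewrite index_uniq //; try lia; auto.
Qed.

Lemma path_edges_graph e :
  e \in path_edges -> (e \subset [set x in p]) && (#|e| == 2).
Proof.
case/path_edgesE=> i lti ->.
rewrite cards2 nth_uniq ?(ltnW lti) // neq_ltn ltnSn andbT.
apply/subsetP=> x; rewrite !inE.
by case/orP=> /eqP ->; apply: mem_nth; rewrite // ltnW.
Qed.

Definition path_graph : sgraph T := SGraph path_edges_graph.

Lemma adj_sym (G : sgraph T) : symmetric (adj G).
Proof. by move=> x y; rewrite /adj setUC. Qed.

Lemma adj_path_graph x y :
  adj path_graph x y -> x \in p /\ (index y p = (index x p).+1 \/ index x p = (index y p).+1).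
Proof.
case/path_edgesE=> i lti E.
have [[-> ->]|[-> ->]] := set2_inj E; rewrite !index_uniq ?mem_nth //; try lia; auto.
Qed.

Lemma path_graph_connected : p != [::] -> connected_graph path_graph.
Proof.
move=> p0; split.
  apply/set0Pn; exists (head x0 p); rewrite inE.
  by case: p p0 => //= a l _; rewrite inE eqxx.
have from0 i : i < size p -> connect (adj path_graph) (nth x0 p 0) (nth x0 p i).
  elim: i => [|i IHi] lti; first exact: connect0.
  apply: connect_trans (IHi (ltnW lti)) (connect1 _).
  exact: path_edgesI.
move=> x y; rewrite !inE => xp yp.
rewrite -(nth_index x0 xp) -(nth_index x0 yp).
apply: connect_trans (from0 _ _); rewrite ?index_mem //.
rewrite (sym_connect_sym (@adj_sym _)).
by apply: from0; rewrite index_mem.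
Qed.

(* On a cycle, the two neighbours of the vertex of maximal index along p would
   both be its predecessor in p. *)
Lemma path_graph_acyclic : acyclic path_graph.
Proof.
move=> q; case: q => [|a0 q0] // szq; apply/negP=> /andP[cq Uq].
set q := a0 :: q0 in szq cq Uq.
have [a aq amax] : exists2 a, a \in q & forall b, b \in q -> index b p <= index a p.
  have a0q : a0 \in q by rewrite inE eqxx.
  by have [a aq amax] := @arg_maxnP _ a0 [in q] (fun x => index x p) a0q; exists a.
have [i r Er] := rot_to aq.
have cr : cycle (adj path_graph) (a :: r) by rewrite -Er rot_cycle.
have Ur : uniq (a :: r) by rewrite -Er rot_uniq.
have sr : size (a :: r) = size q by rewrite -Er size_rot.
have mr x : x \in a :: r -> x \in q by rewrite -Er mem_rot.
(* A cycle of length at least 3 reads [a], [b], ..., [c], with [b] and [c] the two distinct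
   neighbours of [a]. *)
case: r => [|b r] in Er cr Ur sr mr *; first by move: sr szq => /= <-.
case/lastP: r => [|r c] in Er cr Ur sr mr *; first by move: sr szq => /= <-.
move: cr; rewrite /= rcons_path last_rcons => /andP[ab /andP[_ ca]].
have bq : b \in q by apply: mr; rewrite !inE eqxx orbT.
have cq' : c \in q by apply: mr; rewrite !inE mem_rcons inE eqxx !orbT.
have [_ ib] := adj_path_graph ab; have [cp ic] := adj_path_graph ca.
have bp : b \in p by move: ab; rewrite adj_sym => /adj_path_graph[].
have Ebc : index b p = index c p by have := amax _ bq; have := amax _ cq'; lia.
have bc : b = c by rewrite -(nth_index x0 bp) Ebc nth_index.
by move: Ur; rewrite /= bc mem_rcons inE eqxx /= !andbF.
Qed.

(** Along a path without repetition, two distinct edges that meet are consecutive. *)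
Lemma path_edges_alternate (col : {set T} -> bool) :
    (forall i, i.+2 < size p -> col (path_edge i) != col (path_edge i.+1)) ->
  forall e f, e \in path_edges -> f \in path_edges -> e != f ->
    ~~ [disjoint e & f] -> col e != col f.
Proof.
move=> alt e f /path_edgesE[i lti ->] /path_edgesE[j ltj ->] nef.
case/pred0Pn=> x /andP[/= xe xf].
have ij : i <> j by move=> ij; rewrite ij eqxx in nef.
have [Ej|Ei] : j = i.+1 \/ i = j.+1.
- by case: (index_path_edge lti xe); case: (index_path_edge ltj xf); lia.
- by rewrite Ej alt // -Ej.
by rewrite Ei eq_sym alt // -Ei.
Qed.

End PathGraph.

(** * Colorings obtained from classes modulo 4 *)

Definition next_class (T : Type) (cls : T -> nat) : rel T :=
  fun x y => cls y == (cls x).+1 %[mod 4].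

Definition class_color (T : finType) (cls : T -> nat) (e : {set T}) : bool :=
  [exists x in e, exists y in e, next_class cls x y && ~~ odd (cls x)].

(** Since 1 and -1 differ modulo 4, an edge goes to the next class in one direction only, so the
    existential in [class_color] sees no other orientation. Modulo 2 both directions would
    qualify. *)
Lemma class_color_step (T : finType) (cls : T -> nat) x y :
  next_class cls x y -> class_color cls [set x; y] = ~~ odd (cls x).
Proof.
rewrite /next_class => /eqP xy; apply/existsP/idP; last first.
  move=> ev; exists x; rewrite !inE eqxx /=; apply/existsP; exists y.
  by rewrite !inE eqxx orbT /= ev /next_class xy eqxx.
case=> u /andP[+ /existsP[v /andP[+ /andP[/eqP uv +]]]].
by rewrite !inE => /orP[] /eqP Eu /orP[] /eqP Ev; subst; lia.
Qed.

Lemma colorable_of_paths (T : finType) (G : sgraph T) k (cls : T -> nat) :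
    0 < k ->
    (forall S : {set T}, S \subset verts G -> #|S| = k -> exists p : seq T,
      [/\ uniq p, {subset S <= p}, {subset p <= verts G},
          sorted (adj G) p & sorted (next_class cls) p]) ->
  k_proper_colorable k G 2.
Proof.
move=> k0 paths.
exists (fun e => if class_color cls (val e) then ord0 else ord_max).
move=> S SG Sk; have [p [Up Sp pG padj pcls]] := paths S SG Sk.
have [x0 x0S] : exists x0, x0 \in S by apply/set0Pn; rewrite -card_gt0 Sk.
have p0 : p != [::] by apply: contraL (Sp _ x0S) => /eqP ->.
move/(sortedP x0): padj => padj; move/(sortedP x0): pcls => pcls.
exists (path_graph x0 Up); split.
  split.
  - split; [exact: path_graph_connected | exact: path_graph_acyclic].
  - split; first by apply/subsetP=> x; rewrite inE => /pG.
    by apply/subsetP=> _ /path_edgesE[i lti ->]; apply: padj.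
  - by apply/subsetP=> x /Sp; rewrite inE.
have alt i : i.+2 < size p -> class_color cls (path_edge x0 p i)
    != class_color cls (path_edge x0 p i.+1).
  move=> lti; have c1 := pcls _ (ltnW lti); have c2 := pcls _ lti.
  rewrite /path_edge !class_color_step //.
  by move: c1; rewrite /next_class; lia.
move=> e f eH fH ef nd.
have := path_edges_alternate Up alt eH fH ef nd.
by do 2!case: class_color.
Qed.

(** * Lower bound on the number of colors *)

(** Take three vertices. Either the first is adjacent to the other two, or a simple path from it to
    one of them has length at least 2 and begins with two adjacent edges. *)
Lemma adjacent_edges_of_connected (T : finType) (H : sgraph T) :
    connected_graph H -> 2 < #|verts H| ->
  exists x y z, [/\ adj H x y, adj H x z, x != z & y != z].
Proof.
case=> _ conn; rewrite cardE; have := enum_uniq (verts H).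
have : {subset enum (verts H) <= verts H} by move=> x; rewrite mem_enum.
case: (enum _) => [|x [|y [|z l]]] // sub Ul _.
have [xH yH zH] : [/\ x \in verts H, y \in verts H & z \in verts H].
  by split; apply: sub; rewrite !inE eqxx ?orbT.
move: Ul; rewrite /= !inE !negb_or -!andbA => /and4P[xy xz _ /andP[yz _]].
have long w : w \in verts H -> x != w -> adj H x w \/
    exists x y z, [/\ adj H x y, adj H x z, x != z & y != z].
  move=> wH xw; have /connectP[q qp Ew] := conn _ _ xH wH.
  case/shortenP: qp Ew => [[|a [|b q']]] /= qp Uq _ Ew.
  - by rewrite Ew eqxx in xw.
  - by left; rewrite Ew; case/andP: qp.
  right; exists a, x, b; case/and3P: qp => xa ab _.
  move: Uq; rewrite !inE !negb_or -!andbA => /and5P[_ xb _ anb _].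
  by rewrite adj_sym.
case: (long y yH xy) => // axy; case: (long z zH xz) => // axz.
by exists x, y, z.
Qed.

Lemma exists_subset_of_card (T : finType) (U : {set T}) m :
  m <= #|U| -> exists2 A : {set T}, A \subset U & #|A| = m.
Proof.
case/card_geqP=> l [Ul sl lU]; exists [set x in l].
  by apply/subsetP=> x; rewrite inE => /lU.
by rewrite cardsE (card_uniqP Ul).
Qed.

Lemma two_colors_needed (T : finType) (G : sgraph T) k m :
  2 < k -> k <= #|verts G| -> k_proper_colorable k G m -> 2 <= m.
Proof.
move=> k3 kG [c cP].
have [S SG Sk] := exists_subset_of_card kG.
have [H [[[conn _] [_ HG] SH] Hc]] := cP _ SG Sk.
have H3 : 2 < #|verts H| by rewrite (leq_trans k3) // -Sk subset_leq_card.
have [x [y [z [xy xz nxz nyz]]]] := adjacent_edges_of_connected conn H3.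
pose e : edge G := exist (fun e => e \in edges G) _ (subsetP HG _ xy).
pose f : edge G := exist (fun e => e \in edges G) _ (subsetP HG _ xz).
have nef : e != f.
  apply: contraNneq nyz => /(congr1 val) /= /set2_inj[[_ ->] //|[xz' _]].
  by rewrite xz' eqxx in nxz.
have nd : ~~ [disjoint val e & val f].
  by apply/pred0Pn; exists x; rewrite /= !inE eqxx.
have := Hc e f xy xz nef nd; rewrite -val_eqE /=.
have := ltn_ord (c e); have := ltn_ord (c f); lia.
Qed.

(** * Construction of the paths: winding and interleaving *)

Section Winding.
Variables (T : finType) (cls : T -> nat) (S : {set T}).

Let class c := [set x | cls x == c].
Let listing c := enum (class c :&: S) ++ enum (class c :\: S).

Let mem_listing c x : (x \in listing c) = (cls x == c).
Proof. by rewrite mem_cat !mem_enum !inE; case: (x \in S); rewrite ?andbT ?andbF ?orbF. Qed.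

Let uniq_listing c : uniq (listing c).
Proof.
rewrite cat_uniq !enum_uniq andbT /=; apply/hasPn=> x.
by rewrite !mem_enum !inE => /andP[/negPf -> _]; rewrite andbF.
Qed.

Let size_listing c : size (listing c) = #|class c|.
Proof. by rewrite size_cat -!cardE cardsID. Qed.

Let index_listing c x :
  x \in S -> cls x = c -> index x (listing c) < #|class c :&: S|.
Proof.
move=> xS xc; have xI : x \in enum (class c :&: S) by rewrite mem_enum !inE xc eqxx.
by rewrite index_cat xI cardE index_mem.
Qed.

(* In each class the vertices of S come first, so m rounds through the four
   classes exhaust S, unless S consists of m + 1 vertices of a single class d;
   one then starts in d and appends one more vertex of d. *)
Lemma winding_path m :
    (forall x, cls x < 4) -> (forall c, c < 4 -> m <= #|[set x | cls x == c]|) ->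
    #|S| <= m.+1 ->
  exists p, [/\ uniq p, {subset S <= p} & sorted (next_class cls) p].
Proof.
move=> cls4 classm Sm.
have [-> | [x0 x0S]] := set_0Vmem S; first by exists [::]; split=> // x; rewrite inE.
(* The path starts in class [d] and has [4 * m + e] vertices, where [e] is 0 or 1. Its vertex number
   [i] is entry [i %/ 4] of class [(d + i) %% 4]. The last clause inverts this: it locates entry [q]
   of the class of [x]. *)
have [d [e [d4 sz cov]]] : exists d e, [/\ d < 4,
    forall i, i < 4 * m + e -> i %/ 4 < #|class ((d + i) %% 4)|
  & forall x q, x \in S -> q < #|class (cls x) :&: S| ->
      4 * q + (cls x + 4 - d) %% 4 < 4 * m + e].
  have [/existsP[[d d4] /= dm] | ] := boolP [exists d : 'I_4, m < #|class d :&: S|].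
    have Sd : class d :&: S = S.
      by apply/eqP; rewrite eqEcard subsetIr (leq_trans Sm).
    exists d, 1; split=> // [i lti | x q xS].
      have [im | im] := ltnP i (4 * m).
        by apply: leq_trans (classm _ _); lia.
      have -> : i = 4 * m by lia.
      have -> : (d + 4 * m) %% 4 = d by lia.
      by rewrite mulKn //; apply: leq_trans dm (subset_leq_card (subsetIl _ _)).
    have := xS; rewrite -{1}Sd !inE => /andP[/eqP -> _]; rewrite Sd; lia.
  move/existsPn=> few; exists 0, 0; split=> // [i lti | x q xS ltq].
    by apply: leq_trans (classm _ _); lia.
  have := few (Ordinal (cls4 x)); have := cls4 x; rewrite /=; lia.
pose v i := nth x0 (listing ((d + i) %% 4)) (i %/ 4).
have cls_v i : i < 4 * m + e -> cls (v i) = (d + i) %% 4.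
  by move=> lti; apply/eqP; rewrite -mem_listing mem_nth // size_listing sz.
exists (mkseq v (4 * m + e)); split.
- apply/(uniqP x0) => i j; rewrite !inE size_mkseq => lti ltj.
  rewrite !nth_mkseq // => Ev.
  have Ec : (d + i) %% 4 = (d + j) %% 4 by rewrite -!cls_v ?Ev.
  move/eqP: Ev; rewrite /v Ec nth_uniq ?size_listing ?sz -?Ec ?sz //.
  by move/eqP; lia.
- move=> x xS; have ltq := index_listing xS (erefl _).
  have lti := cov _ _ xS ltq; have := cls4 x.
  set q := index _ _ in ltq lti * => x4.
  apply/(nthP x0); exists (4 * q + (cls x + 4 - d) %% 4); rewrite ?size_mkseq //.
  rewrite nth_mkseq // /v.
  have -> : (d + (4 * q + (cls x + 4 - d) %% 4)) %% 4 = cls x by lia.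
  have -> : (4 * q + (cls x + 4 - d) %% 4) %/ 4 = q by lia.
  by rewrite nth_index // mem_listing.
apply/(sortedP x0) => i; rewrite size_mkseq => lti.
rewrite /next_class !nth_mkseq ?cls_v //; lia.
Qed.

End Winding.

(* Sort the vertices by f and interleave the first half of the resulting list
   with the second: neighbours end up at distance at least uphalf #|T| - 1 in the
   sorted list, where each fiber of f is an interval. *)
Lemma interleaving (T : finType) (f : T -> nat) M :
    (forall x, f x <= M) -> 2 * #|[set x | f x == M]| <= #|T| ->
    (forall c, c != M -> 2 * #|[set x | f x == c]| < #|T|) ->
  exists p, [/\ uniq p, forall x, x \in p & sorted (fun x y => f x != f y) p].
Proof.
move=> fM topM top.
have [x0 _ | T0] := pickP T; last by exists [::]; split=> // x; have := T0 x.
pose v := sort (relpre f leq) (enum T); pose N := #|T|; pose h := uphalf N.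
have szv : size v = N by rewrite size_sort -cardE.
have Uv : uniq v by rewrite sort_uniq enum_uniq.
have mono i j : i <= j -> j < N -> f (nth x0 v i) <= f (nth x0 v j).
  move=> ij jN; apply: (@sorted_leq_nth _ (relpre f leq)) => //.
  - by move=> y x z; apply: leq_trans.
  - by move=> x; apply: leqnn.
  - by apply: sort_sorted => x y; apply: leq_total.
  - by rewrite inE szv (leq_ltn_trans ij).
  - by rewrite inE szv.
(* By monotonicity [f] is constant between positions [a] and [b], which hold [b - a + 1] distinct
   vertices. *)
have fiber a b : a <= b -> b < N -> f (nth x0 v a) = f (nth x0 v b) ->
    b - a < #|[set x | f x == f (nth x0 v a)]|.
  move=> ab bN Eab; rewrite cardE.
  have -> : (b - a).+1 = size [seq nth x0 v i | i <- iota a (b - a).+1].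
    by rewrite size_map size_iota.
  apply: uniq_leq_size.
    rewrite map_inj_in_uniq ?iota_uniq // => i j; rewrite !mem_iota => iI jI.
    by move/eqP; rewrite nth_uniq ?szv //; try lia; move/eqP.
  move=> x /mapP[i]; rewrite mem_iota => iI ->; rewrite mem_enum inE eqn_leq.
  by rewrite {1}Eab !mono //; lia.
have far a b : a < h -> h <= b -> b < N -> h.-1 <= b - a ->
    f (nth x0 v a) != f (nth x0 v b).
  move=> ah hb bN dist; apply/eqP=> Eab.
  (* The fiber of [M] ends the sorted list, so if it contained position [a < h] it would fill more
     than half of it. Any other fiber would have at least [h] elements, against the strict bound. *)
  have [EM | nM] := eqVneq (f (nth x0 v a)) M.
    have Ea : f (nth x0 v a) = f (nth x0 v N.-1).
      by apply/eqP; rewrite eqn_leq mono ?EM ?fM //; lia.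
    have := fiber a N.-1 _ _ Ea; rewrite EM; lia.
  have := fiber a b _ bN Eab; have := top _ nM; lia.
(* Even indices run through the first half, odd ones through the second, so consecutive positions
   differ by [h] or [h.-1]. *)
pose pos i := (if odd i then h else 0) + i./2.
have posN i : i < N -> pos i < N by rewrite /pos; case: ifP; lia.
have Up : uniq (mkseq (fun i => nth x0 v (pos i)) N).
  apply/(uniqP x0) => i j; rewrite !inE size_mkseq => iN jN.
  rewrite !nth_mkseq // => /eqP; rewrite nth_uniq ?szv ?posN // => /eqP.
  by rewrite /pos; case: ifP; case: ifP; lia.
exists (mkseq (fun i => nth x0 v (pos i)) N); split=> //.
  move=> x; have [||_ ->] := @uniq_min_size _ _ (enum T) Up.
  - by move=> y _; rewrite mem_enum.
  - by rewrite size_mkseq -cardE.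
  by rewrite mem_enum.
apply/(sortedP x0) => i; rewrite size_mkseq => iN; rewrite !nth_mkseq //; try lia.
rewrite /pos /=; case: ifP => oi /=.
  by rewrite eq_sym; apply: far; lia.
by apply: far; lia.
Qed.

(** * Two colors suffice in either case *)

(** The same path serves every [S]. Its indices can be the classes because [next_class] compares
    them modulo 4. *)
Lemma colorable_of_hamiltonian_path (T : finType) (G : sgraph T) k p :
    0 < k -> verts G = [set: T] -> uniq p -> (forall x, x \in p) ->
    sorted (adj G) p ->
  k_proper_colorable k G 2.
Proof.
move=> k0 GT Up pT padj; apply: (@colorable_of_paths _ _ _ (index^~ p)) => //.
move=> S _ _; exists p; split=> // [x|]; first by rewrite GT inE.
have [x0 _|T0] := pickP T; last by case: p Up pT padj => // x; have := T0 x.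
apply/(sortedP x0) => i lti.
by rewrite /next_class !index_uniq ?(ltnW lti).
Qed.

(** Cutting [k.-1] vertices off each side leaves at least [k.-1] there, so [winding_path] applies
    with [m = k.-1], and a set of [k] vertices meets its bound [m.+1]. *)
Lemma colorable_of_bipartition (T : finType) (G : sgraph T) k (V : {set T}) :
    0 < k -> verts G = [set: T] ->
    (forall x y, (x \in V) != (y \in V) -> adj G x y) ->
    2 * k.-1 <= #|V| -> 2 * k.-1 <= #|~: V| ->
  k_proper_colorable k G 2.
Proof.
move=> k0 GT bip kV kU.
have [A AU Ak] : exists2 A : {set T}, A \subset ~: V & #|A| = k.-1.
  by apply: exists_subset_of_card; lia.
have [P PV Pk] : exists2 P : {set T}, P \subset V & #|P| = k.-1.
  by apply: exists_subset_of_card; lia.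
pose cls x := if x \in V then (if x \in P then 0 else 2)
              else (if x \in A then 1 else 3).
have oddcls x : odd (cls x) = (x \notin V) by rewrite /cls; do 2!case: ifP.
apply: (@colorable_of_paths _ _ _ cls) => // S _ Sk.
have [|||p [Up Sp pcls]] := @winding_path _ cls S k.-1.
- by move=> x; rewrite /cls; do 2!case: ifP.
- have clsE c (B : {set T}) : k.-1 <= #|B| -> {in B, forall x, cls x = c} ->
      k.-1 <= #|[set x | cls x == c]|.
    move=> kB Bc; apply: leq_trans kB (subset_leq_card _).
    by apply/subsetP=> x xB; rewrite inE Bc.
  case=> [|[|[|[|//]]]] _.
  + apply: (clsE _ P) => [|x xP]; first by rewrite Pk.
    by rewrite /cls xP (subsetP PV).
  + apply: (clsE _ A) => [|x xA]; first by rewrite Ak.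
    by rewrite /cls xA; have := subsetP AU _ xA; rewrite inE => /negPf ->.
  + apply: (clsE _ (V :\: P)) => [|x].
      by rewrite cardsD (setIidPr PV) Pk; lia.
    by rewrite inE /cls => /andP[/negPf -> ->].
  + apply: (clsE _ (~: V :\: A)) => [|x].
      by rewrite cardsD (setIidPr AU) Ak; lia.
    by rewrite !inE /cls => /andP[/negPf -> /negPf ->].
- by rewrite Sk; lia.
exists p; split=> // [x|]; first by rewrite GT inE.
apply: sub_sorted pcls => x y xy; apply: bip.
have : odd (cls y) = ~~ odd (cls x) by move: xy; rewrite /next_class; lia.
by rewrite !oddcls negbK => <-; case: (y \in V).
Qed.

(** * Application to complete multipartite graphs *)

Section Multipartite.
Variables (r : nat) (n : r.-tuple nat).

Lemma adj_multipartite x y :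
  adj (complete_multipartite n) x y = (tag x != tag y).
Proof.
apply/imset2P/idP => [[a b _ + E]|xy]; last by exists x y; rewrite ?inE.
rewrite !inE /=.
by have [[-> ->]|[-> ->]] := set2_inj E; rewrite // eq_sym.
Qed.

Lemma card_part i : #|[set x : mp_vertex n | tag x == i]| = tnth n i.
Proof.
have inj : injective (Tagged (fun i => 'I_(tnth n i)) : 'I_(tnth n i) -> mp_vertex n).
  by move=> a b /eqP; rewrite eq_Tagged => /eqP.
rewrite -[RHS]card_ord -cardsT -(card_imset _ inj).
apply: eq_card => -[i' j]; rewrite inE /=.
apply/eqP/imsetP => [Ei|[a _ /(congr1 (@tag _ _))]] //.
by case: _ / Ei in j *; exists j.
Qed.

Lemma card_mp_vertex : #|mp_vertex n| = \sum_(i < r) nth 0 n i.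
Proof.
rewrite -sum1_card (partition_big (@tag _ _) predT) //=.
by apply: eq_bigr => i _; rewrite -(tnth_nth 0) -card_part -sum1dep_card.
Qed.

End Multipartite.

(* [path leq 1 n] says 1 <= n_1 <= n_2 <= ... <= n_r *)
Theorem theorem12 (r : nat) (n : r.-tuple nat) (k : nat)
    (hr : 3 <= r) (hn : path leq 1 n)
    (hk3 : 3 <= k) (hk : k <= #|verts (complete_multipartite n)|) :
  let s := \sum_(i < r.-1) nth 0 n i in
  let t := nth 0 n r.-1 in
  ((s <= t /\ 2 * (k - 1) <= s) \/ t <= s) ->
  is_proper_index k (complete_multipartite n) 2.
Proof.
case: r n hr hn hk => // r n hr hn hk s t st; split; last by move=> m; apply: two_colors_needed.
have k0 : 0 < k by lia.
have cardT : #|mp_vertex n| = s + t by rewrite card_mp_vertex big_ord_recr.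
pose V := [set x : mp_vertex n | tag x == ord_max].
have cardV : #|V| = t by rewrite card_part (tnth_nth 0).
have [[st1 ks]|ts] := st.
  apply: (@colorable_of_bipartition _ _ _ V) => //.
  - move=> x y; rewrite adj_multipartite !inE.
    by apply: contraNneq => ->.
  - by rewrite cardV; lia.
  - by have := cardsC V; rewrite cardT cardV; lia.
have ge1 i : i < r.+1 -> 1 <= nth 0 n i.
  move=> ir; have /allP := order_path_min leq_trans hn.
  by apply; rewrite mem_nth ?size_tuple.
have le_t i : i < r.+1 -> nth 0 n i <= t.
  move=> ir; apply: (sorted_leq_nth leq_trans leqnn) => //.
  - exact: path_sorted hn.
  - by rewrite inE size_tuple.
  - by rewrite inE size_tuple.
have fiberE c (cr : c < r.+1) :
    #|[set x : mp_vertex n | tag x == c :> nat]| = nth 0 n c.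
  have := card_part n (Ordinal cr); rewrite (tnth_nth 0) => <-.
  by apply: eq_card => x; rewrite !inE.
(* The number of parts is now [r.+1], so [M = r] is the index of the largest part, for which the
   bound [2 * t <= s + t] is [t <= s]. *)
have [|||p [Up pT padj]] := @interleaving (mp_vertex n) (fun x => tag x) r.
- by move=> x; rewrite -ltnS.
- by rewrite fiberE // -/t cardT; lia.
- move=> c cr; have [cltr|rc] := ltnP c r.+1; last first.
    rewrite eq_card0 ?cardT; last first.
      by move=> x; rewrite !inE; have := ltn_ord (tag x); lia.
    by have t1 : 0 < t := ge1 r (ltnSn r); rewrite muln0 addn_gt0 t1 orbT.
  rewrite fiberE // cardT.
  have cr' : c < r by lia.
  (* A second part [d] among the first [r >= 2] makes the bound strict: with sizes [n_c + n_d <= s],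
     [1 <= n_d] and [n_c <= t], it follows that [2 * n_c < s + t]. The witness is 1 if [c] is 0, and
     0 otherwise. *)
  have [d dr dc] : exists2 d, d < r & d != c.
    by exists (c == 0 : nat); [move: hr|]; case: (c) => *; lia.
  have : nth 0 n c + nth 0 n d <= s.
    rewrite /s (bigD1 (Ordinal cr')) //= (bigD1 (Ordinal dr)) //= addnA.
    exact: leq_addr.
  by have := ge1 d (ltnW dr); have := le_t c cltr; lia.
apply: (colorable_of_hamiltonian_path k0 _ Up pT) => //.
by apply: sub_sorted padj => x y; rewrite adj_multipartite.
Qed.
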